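(* Let $\alpha$, $\beta$, $\sigma$ be vincular patterns. If $\alpha$ and $\beta$ are filling-shape-Wilf-equivalent, then $\alpha\oplus\sigma$ and $\beta\oplus\sigma$ are filling-shape-Wilf-equivalent.
   Context: A vincular pattern of length $k$ is a pair $(\sigma,X)$ with $\sigma\in S_k$ and $X\subseteq[k-1]$. It is written as $\sigma$ with a dash between $\sigma_j$ and $\sigma_{j+1}$ exactly when $j\notin X$. Direct sum: for $(\sigma,A)$ of length $k$ and $(\tau,B)$ of length $\ell$, $(\sigma,A)\oplus(\tau,B)=(\sigma_1\cdots\sigma_k(\tau_1+k)\cdots(\tau_\ell+k),\ A\cup\{i+k:i\in B\})$. A Young board $\lambda=(\lambda_1,\dots,\lambda_n)$ with $\lambda_1\ge\dots\ge\lambda_n>0$ is the cell set $\{(i,j):1\le i\le n,\ 1\le j\le\lambda_i\}$, with width $n$ and height $\lambda_1$. A filling is a $0/1$ assignment to the cells with at most one $1$ per row and per column. It is encoded by the word $\pi_1\cdots\pi_n$ with $\pi_c=r$ if $(c,r)$ holds a $1$ and $\pi_c=\square$ if column $c$ is empty. A filling $\pi$ contains $(\sigma,X)$ if there are $i_1<\dots<i_k$ such that all of the following hold: - all $\pi_{i_j}$ are numbers; - $\pi_{i_1}\cdots\pi_{i_k}$ is order-isomorphic to $\sigma$; - $i_{j+1}=i_j+1$ for $j\in X$; - the cell $(i_k,\max_j\pi_{i_j})$ lies in $\lambda$. Otherwise $\pi$ avoids $(\sigma,X)$. $\mathcal{S}_\lambda^{C,R}(\sigma)$ denotes the set of fillings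 of $\lambda$ with empty columns exactly $C$ and empty rows exactly $R$ that avoid $\sigma$. Two vincular patterns $\sigma,\tau$ are filling-shape-Wilf-equivalent if $|\mathcal{S}_\lambda^{C,R}(\sigma)|=|\mathcal{S}_\lambda^{C,R}(\tau)|$ for all Young boards $\lambda$ and all $C\subseteq[\text{width}(\lambda)]$, $R\subseteq[\text{height}(\lambda)]$. *)

(* Defs.v *)
From mathcomp Require Import all_boot all_fingroup.

Set Implicit Arguments.
Unset Strict Implicit.
Unset Printing Implicit Defensive.

(* All indices (positions, values, rows, columns) start at 0 instead of 1. *)

(* A vincular pattern has length [(vdeg p).+1]; lengths are positive since
   containment refers to the last letter and to the maximum of an occurrence.
   [j \in vadj p] says that letters j and j+1 (0-based) are adjacent, i.e.
   that j+1 belongs to the set X of the 1-based notation. *)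
Record vincular := Vincular {
  vdeg : nat;
  vperm : 'S_vdeg.+1;
  vadj : {set 'I_vdeg}
}.

Definition dsum_fun k l (s : 'S_k) (t : 'S_l) (x : 'I_(k + l)) : 'I_(k + l) :=
  match split x with
  | inl a => lshift l (s a)
  | inr b => rshift k (t b)
  end.

Lemma dsum_fun_inj k l (s : 'S_k) (t : 'S_l) : injective (dsum_fun s t).
Proof.
move=> x y; rewrite /dsum_fun -[x]splitK -[y]splitK !unsplitK.
case: (split x) => a; case: (split y) => b /= /eqP.
- by rewrite eq_lshift => /eqP /perm_inj ->.
- by rewrite eq_lrshift.
- by rewrite eq_rlshift.
- by rewrite eq_rshift => /eqP /perm_inj ->.
Qed.

Definition dsum_perm k l (s : 'S_k) (t : 'S_l) : 'S_(k + l) :=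
  perm (@dsum_fun_inj k l s t).

(* [(vdeg p).+1 + (vdeg q).+1] is convertible to [(vdeg p + (vdeg q).+1).+1];
   [rshift (vdeg p) (lift ord0 i)] is i shifted by the length of [p]. *)
Definition dsum (p q : vincular) : vincular :=
  @Vincular (vdeg p + (vdeg q).+1)
    (dsum_perm (vperm p) (vperm q))
    ([set lshift (vdeg q).+1 i | i in vadj p]
       :|: [set rshift (vdeg p) (lift ord0 i) | i in vadj q]).

(* [la] lists the column heights. *)
Definition young_board (la : seq nat) : bool :=
  sorted geq la && all (fun x => 0 < x) la.

Definition width (la : seq nat) : nat := size la.
Definition height (la : seq nat) : nat := head 0 la.

Definition in_board (la : seq nat) (c r : nat) : bool := r < nth 0 la c.

Section Fillings.

Variable la : seq nat.

Definition cell := ('I_(width la) * 'I_(height la))%type.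

(* A 0/1 assignment is given by the set of cells that hold a 1. *)
Implicit Type F : {set cell}.

Definition filling F : bool :=
  [&& [forall x in F, in_board la x.1 x.2],
      [forall x in F, forall y in F, (x.1 == y.1) ==> (x == y)] &
      [forall x in F, forall y in F, (x.2 == y.2) ==> (x == y)]].

Definition word F (c : 'I_(width la)) : option 'I_(height la) :=
  [pick r | (c, r) \in F].

(* The occurrence is at columns [i] and reads the rows [v]. *)
Definition contains F (p : vincular) : bool :=
  [exists i : {ffun 'I_(vdeg p).+1 -> 'I_(width la)},
   exists v : {ffun 'I_(vdeg p).+1 -> 'I_(height la)},
   [&& [forall a : 'I_(vdeg p).+1, forall b : 'I_(vdeg p).+1,
          (a < b) ==> (i a < i b)],
       [forall a, word F (i a) == Some (v a)],
       [forall a : 'I_(vdeg p).+1, forall b : 'I_(vdeg p).+1,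
          (v a < v b) == (vperm p a < vperm p b)],
       [forall j in vadj p,
          val (i (lift ord0 j)) == (i (widen_ord (leqnSn _) j)).+1] &
       in_board la (i ord_max) (\max_(a < (vdeg p).+1) v a)]].

Definition empty_columns F : {set 'I_(width la)} :=
  [set c | [forall r, (c, r) \notin F]].

Definition empty_rows F : {set 'I_(height la)} :=
  [set r | [forall c, (c, r) \notin F]].

Definition avoiders (C : {set 'I_(width la)}) (R : {set 'I_(height la)})
    (p : vincular) : {set {set cell}} :=
  [set F | [&& filling F, empty_columns F == C, empty_rows F == R
             & ~~ contains F p]].

End Fillings.

Definition filling_shape_Wilf_equivalent (p q : vincular) : Prop :=
  forall la : seq nat, young_board la ->
  forall (C : {set 'I_(width la)}) (R : {set 'I_(height la)}),
    #|avoiders C R p| = #|avoiders C R q|.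

(* Main.v *)
(* Call a cell good if an occurrence of sigma lies strictly to its north-east.
   The good cells form a Young board, and a filling avoids alpha (+) sigma iff
   its restriction to the good cells avoids alpha. The good cells depend only
   on the entries outside them. So, among the fillings with prescribed empty
   columns and rows, fix the good cells and the entries outside: the entries
   inside are then an arbitrary filling of the smaller board with prescribed
   empty columns and rows, where the equivalence of alpha and beta applies. *)

Require Import Defs.
From mathcomp Require Import all_boot all_fingroup.

Set Implicit Arguments.
Unset Strict Implicit.
Unset Printing Implicit Defensive.

(** * Occurrences of a pattern with natural-number coordinates *)

Definition one_at (la : seq nat) (F : {set cell la}) (c r : nat) : Prop :=
  exists2 x, x \in F & x.1 = c :> nat /\ x.2 = r :> nat.

(** This is the part of containment that mentions neither board nor filling. Positions and values
    are plain naturals, so an occurrence passes from one board to another without casts. *)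
Definition matches (p : vincular) (i v : 'I_(vdeg p).+1 -> nat) : Prop :=
  [/\ forall a b : 'I_(vdeg p).+1, a < b -> i a < i b,
      forall a b, (v a < v b) = (vperm p a < vperm p b) &
      forall j, j \in vadj p ->
        i (lift ord0 j) = (i (widen_ord (leqnSn _) j)).+1].

Lemma matches_last p i v a : @matches p i v -> i a <= i ord_max.
Proof.
case=> inc _ _; have := leq_ord a; rewrite leq_eqVlt => /orP[/eqP e|lt].
  by rewrite (_ : a = ord_max) //; apply: val_inj.
exact: ltnW (inc a ord_max lt).
Qed.

(** The values are ordered like [vperm p], so the maximum sits at the preimage of its largest
    value. *)
Lemma matches_argmax p i v :
  @matches p i v -> exists m, forall a, v a <= v m.
Proof.
case=> _ iso _; exists ((vperm p)^-1%g ord_max) => a.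
by rewrite leqNgt iso permKV -leqNgt leq_ord.
Qed.

(** * Occurrences of a direct sum *)

Section DirectSum.

Variables p q : vincular.

Definition dsuml (a : 'I_(vdeg p).+1) : 'I_(vdeg (dsum p q)).+1 :=
  lshift (vdeg q).+1 a.

Definition dsumr (b : 'I_(vdeg q).+1) : 'I_(vdeg (dsum p q)).+1 :=
  @rshift (vdeg p).+1 (vdeg q).+1 b.

Definition dsum_case T (f : 'I_(vdeg p).+1 -> T) (g : 'I_(vdeg q).+1 -> T)
    (x : 'I_(vdeg (dsum p q)).+1) : T :=
  match @split (vdeg p).+1 (vdeg q).+1 x with inl a => f a | inr b => g b end.

Lemma dsum_casel T f g a : @dsum_case T f g (dsuml a) = f a.
Proof. by rewrite /dsum_case (unsplitK (inl a)). Qed.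

Lemma dsum_caser T f g b : @dsum_case T f g (dsumr b) = g b.
Proof. by rewrite /dsum_case (unsplitK (inr b)). Qed.

Lemma dsum_ind (P : 'I_(vdeg (dsum p q)).+1 -> Prop) :
  (forall a, P (dsuml a)) -> (forall b, P (dsumr b)) -> forall x, P x.
Proof.
move=> Pl Pr x; rewrite -[x](@splitK (vdeg p).+1 (vdeg q).+1).
by case: (split _) => [a|b]; [apply: Pl | apply: Pr].
Qed.

Lemma vperm_dsuml a : vperm (dsum p q) (dsuml a) = dsuml (vperm p a).
Proof. by rewrite /= permE /dsum_fun (unsplitK (inl a)). Qed.

Lemma vperm_dsumr b : vperm (dsum p q) (dsumr b) = dsumr (vperm q b).
Proof. by rewrite /= permE /dsum_fun (unsplitK (inr b)). Qed.

Lemma dsumr_max : dsumr ord_max = ord_max.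
Proof. by apply: val_inj; rewrite /= addSn -addnS. Qed.

Lemma dsuml_lt_dsumr a b : dsuml a < dsumr b.
Proof. by rewrite /= ltn_addr. Qed.

Lemma ltn_dsumr b b' : (dsumr b < dsumr b') = (b < b').
Proof. by rewrite /= ltn_add2l. Qed.

Lemma matches_dsum i v :
  @matches (dsum p q) i v <->
  [/\ @matches p (i \o dsuml) (v \o dsuml),
      @matches q (i \o dsumr) (v \o dsumr),
      forall a b, i (dsuml a) < i (dsumr b) &
      forall a b, v (dsuml a) < v (dsumr b)].
Proof.
(* Both halves of the adjacency set are translated to letters of the summands. The index [vdeg p],
   which would tie the last letter of [p] to the first of [q], lies in neither half, so the two
   blocks may be any distance apart. *)
have ll j : lift ord0 (lshift (vdeg q).+1 j) = dsuml (lift ord0 j).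
  exact: val_inj.
have wl j : widen_ord (leqnSn _) (lshift (vdeg q).+1 j)
    = dsuml (widen_ord (leqnSn _) j).
  exact: val_inj.
have lr j : lift ord0 (rshift (vdeg p) (lift ord0 j)) = dsumr (lift ord0 j).
  exact: val_inj.
have wr j : widen_ord (leqnSn _) (rshift (vdeg p) (lift ord0 j))
    = dsumr (widen_ord (leqnSn _) j).
  by apply: val_inj; rewrite /= /bump /= addnCA.
split=> [[inc iso adj] | [[incp isop adjp] [incq isoq adjq] ipq vpq]].
  split=> [||a b|a b].
  - split=> [a b lt_ab|a b|j jp] /=; first exact: inc.
      by rewrite iso !vperm_dsuml.
    rewrite -ll -wl; apply: adj.
    by rewrite inE; apply/orP; left; apply: imset_f.
  - split=> [a b lt_ab|a b|j jq] /=.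
    + by apply: inc; rewrite ltn_dsumr.
    + by rewrite iso !vperm_dsumr ltn_dsumr.
    + rewrite -lr -wr; apply: adj.
      by rewrite inE; apply/orP; right; apply: imset_f.
  - by apply: inc; apply: dsuml_lt_dsumr.
  - by rewrite iso vperm_dsuml vperm_dsumr dsuml_lt_dsumr.
split.
- elim/dsum_ind => a; elim/dsum_ind => b //.
  + exact: incp.
  + by rewrite ltnNge ltnW // dsuml_lt_dsumr.
  + by rewrite ltn_dsumr; apply: incq.
- elim/dsum_ind => a; elim/dsum_ind => b; rewrite ?vperm_dsuml ?vperm_dsumr.
  + exact: isop.
  + by rewrite vpq dsuml_lt_dsumr.
  + apply/idP/idP => lt.
      by have := ltn_trans lt (vpq b a); rewrite ltnn.
    by have := ltn_trans lt (dsuml_lt_dsumr (vperm p b) (vperm q a)); rewrite ltnn.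
  + by rewrite ltn_dsumr; apply: isoq.
- move=> j /setUP[] /imsetP[j' j'A ->].
  + by rewrite ll wl; apply: adjp.
  + by rewrite lr wr; apply: adjq.
Qed.

End DirectSum.

(** * Young boards as bounded down-sets of cells *)

Lemma in_board_le la c r c' r' :
  young_board la -> c' <= c -> r' <= r -> in_board la c r -> in_board la c' r'.
Proof.
case/andP=> srt _ lec ler; rewrite /in_board => /(leq_ltn_trans ler) lt.
apply: (leq_trans lt); have [le|gt] := leqP (size la) c.
  by rewrite [X in X <= _]nth_default.
apply: (sorted_leq_nth _ _ 0 srt) => //.
- by move=> x y z /= h1 h2; apply: leq_trans h2 h1.
- by move=> x /=.
- by rewrite inE (leq_ltn_trans lec).
Qed.

Lemma in_board_width la c r : in_board la c r -> c < width la.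
Proof.
by rewrite /in_board /width [c < _]ltnNge; apply: contraL => ?; rewrite nth_default.
Qed.

Lemma in_board_height la c r :
  young_board la -> in_board la c r -> r < height la.
Proof.
move=> yla /(in_board_le yla (leq0n c) (leqnn r)).
by rewrite /in_board /height nth0.
Qed.

Lemma young_board_of_downset (g : nat -> nat -> bool) w h :
  (forall c r, g c r -> c < w /\ r < h) ->
  (forall c r c' r', c' <= c -> r' <= r -> g c r -> g c' r') ->
  exists2 la, young_board la & forall c r, in_board la c r = g c r.
Proof.
move=> bnd down.
(* The height of column [c] is the first row where [g c] fails, or [h] if there is none. *)
pose ht c := find (predC (g c)) (iota 0 h).
have htE c r : (r < ht c) = g c r.
  rewrite /ht; apply/idP/idP => [lt|gcr].
    have := before_find 0 lt; rewrite nth_iota ?add0n /= => [/negbFE //|].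
    by rewrite (leq_trans lt) // (leq_trans (find_size _ _)) ?size_iota.
  rewrite ltnNge; apply/negP => le.
  have [_ rh] := bnd _ _ gcr.
  have hs : has (predC (g c)) (iota 0 h).
    by rewrite has_find size_iota (leq_ltn_trans le).
  have := nth_find 0 hs; rewrite nth_iota ?add0n /=; last exact: leq_ltn_trans le rh.
  by move/negP; apply; apply: down gcr.
(* The board is cut at the first column of height 0, since [young_board] requires positive heights;
   monotonicity of [g] makes all later columns empty too. *)
pose n := find (fun c => ht c == 0) (iota 0 w).
have nE c : (c < n) = (0 < ht c).
  apply/idP/idP => [lt|].
    have := before_find 0 lt; rewrite nth_iota ?add0n => [/negbT|].
      by rewrite lt0n.
    by rewrite (leq_trans lt) // (leq_trans (find_size _ _)) ?size_iota.
  rewrite htE => gc0; rewrite ltnNge; apply/negP => le.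
  have [cw _] := bnd _ _ gc0.
  have hs : has (fun c => ht c == 0) (iota 0 w).
    by rewrite has_find size_iota (leq_ltn_trans le).
  have := nth_find 0 hs; rewrite nth_iota ?add0n; last exact: leq_ltn_trans le cw.
  rewrite -/n; apply/negP; rewrite -lt0n htE; exact: down gc0.
exists (mkseq ht n).
  apply/andP; split; last first.
    by apply/allP => x /mapP[c]; rewrite mem_iota /= => lt ->; rewrite -nE.
  rewrite /mkseq; apply: (homo_sorted (e := leq)); last exact: iota_sorted.
  move=> c c' le /=; rewrite leqNgt htE; apply/negP => gc'.
  by have := down _ _ _ _ le (leqnn _) gc'; rewrite -htE ltnn.
move=> c r; rewrite /in_board; have [lt|ge] := ltnP c n.
  by rewrite nth_mkseq.
rewrite nth_default ?size_mkseq // ltn0; apply/esym/negbTE.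
by rewrite -htE -leqNgt (leq_trans _ (leq0n r)) // leqNgt -nE -leqNgt.
Qed.

(** * Fillings and containment *)

Section Filling.

Variable la : seq nat.
Implicit Type F : {set cell la}.

Lemma fillingP F :
  reflect [/\ forall x, x \in F -> in_board la x.1 x.2,
              {in F &, injective fst} & {in F &, injective snd}] (filling F).
Proof.
apply: (iffP and3P) => [[/forall_inP bd /forall_inP fc /forall_inP fr]|[bd fc fr]].
  by split=> // x y xF yF /eqP e; apply/eqP;
    [have /forall_inP/(_ y yF) := fc x xF | have /forall_inP/(_ y yF) := fr x xF];
    rewrite e.
split; apply/forall_inP => x xF; first exact: bd.
  by apply/forall_inP => y yF; apply/implyP => /eqP /fc ->.
by apply/forall_inP => y yF; apply/implyP => /eqP /fr ->.
Qed.

Lemma filling_sub F F' : F' \subset F -> filling F -> filling F'.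
Proof.
move=> /subsetP sub /fillingP[bd fc fr]; apply/fillingP; split.
- by move=> x /sub /bd.
- exact: sub_in2 fc.
- exact: sub_in2 fr.
Qed.

Lemma word_filling F c r :
  filling F -> (word F c == Some r) = ((c, r) \in F).
Proof.
move=> /fillingP[_ fc _]; rewrite /word; case: pickP => [r' r'F|->] //.
apply/eqP/idP => [[<-] //|rF].
by have [->] : (c, r') = (c, r) by apply: fc.
Qed.

(** The maximum of the values is attained, so its being in the board at the last column amounts to a
    condition on each letter separately. *)
Lemma containsP F p :
  filling F ->
  reflect (exists i v, [/\ @matches p i v, forall a, one_at F (i a) (v a) &
             forall a, in_board la (i ord_max) (v a)])
          (contains F p).
Proof.
move=> fF; apply: (iffP existsP).
  case=> i /existsP[v /and5P[/forallP inc /forallP wrd /forallP iso]].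
  move=> /forall_inP adj bd; exists (fun a => val (i a)), (fun a => val (v a)); split.
  - split=> [a b|a b|j /adj/eqP //].
    + by have /forallP/(_ b)/implyP := inc a.
    + by have /forallP/(_ b)/eqP := iso a.
  - by move=> a; exists (i a, v a); rewrite // -word_filling.
  - by move=> a; apply: leq_ltn_trans bd; apply: (@leq_bigmax _ (fun a => val (v a))).
case=> i [v [[inc iso adj] one bd]].
(* Finite choice: one cell per letter supplies the columns and the rows simultaneously. *)
have [x xP] : exists x : {ffun 'I_(vdeg p).+1 -> cell la},
    forall a, [&& x a \in F, (x a).1 == i a :> nat & (x a).2 == v a :> nat].
  have ex a : exists x : cell la, [&& x \in F, x.1 == i a :> nat & x.2 == v a :> nat].
    by case: (one a) => x xF [<- <-]; exists x; rewrite xF !eqxx.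
  by exists [ffun a => xchoose (ex a)] => a; rewrite ffunE; exact: (xchooseP (ex a)).
have x1 a : val (x a).1 = i a by case/and3P: (xP a) => _ /eqP.
have x2 a : val (x a).2 = v a by case/and3P: (xP a) => _ _ /eqP.
exists [ffun a => (x a).1]; apply/existsP; exists [ffun a => (x a).2].
apply/and5P; split.
- by apply/forallP => a; apply/forallP => b; apply/implyP; rewrite !ffunE !x1; apply: inc.
- apply/forallP => a; rewrite !ffunE word_filling // -surjective_pairing.
  by case/and3P: (xP a).
- by apply/forallP => a; apply/forallP => b; rewrite !ffunE !x2 iso.
- by apply/forall_inP => j jA; rewrite !ffunE !x1 adj.
- rewrite ffunE x1.
  have [|m ->] := @eq_bigmax _ (fun a => val ([ffun a => (x a).2] a)).
    by rewrite card_ord.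
  by rewrite ffunE x2.
Qed.

Lemma empty_columnsE F : empty_columns F = ~: (fst @: F).
Proof.
apply/setP => c; rewrite !inE; apply/forallP/negP => [h /imsetP[[c' r] xF /= e]|h r].
  by have := h r; rewrite e xF.
by apply/negP => xF; apply: h; apply/imsetP; exists (c, r).
Qed.

Lemma empty_rowsE F : empty_rows F = ~: (snd @: F).
Proof.
apply/setP => r; rewrite !inE; apply/forallP/negP => [h /imsetP[[c r'] xF /= e]|h c].
  by have := h c; rewrite e xF.
by apply/negP => xF; apply: h; apply/imsetP; exists (c, r).
Qed.

(** * Good cells and their stability *)

Definition good (s : vincular) F (c r : nat) : bool :=
  contains [set y : cell la in F | (c < y.1) && (r < y.2)] s.

Definition good_cells (s : vincular) F : {set cell la} :=
  [set x : cell la | good s F x.1 x.2].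

(** Only the ones are restricted to the north-east of [(c, r)]; the corner of the occurrence is
    still tested against the whole of [la]. *)
Lemma goodP s F c r :
  filling F ->
  reflect (exists i v, [/\ @matches s i v, forall a, one_at F (i a) (v a),
             forall a, c < i a /\ r < v a &
             forall a, in_board la (i ord_max) (v a)])
          (good s F c r).
Proof.
move=> fF; have sub : [set y : cell la in F | (c < y.1) && (r < y.2)] \subset F.
  by apply/subsetP => y; rewrite inE => /andP[].
apply: (iffP (containsP s (filling_sub sub fF))) => -[i [v]].
  case=> m one bd; exists i, v; split=> // a; case: (one a) => x.
    by rewrite inE => /andP[xF _] e; exists x.
  by rewrite inE => /andP[_ /andP[h1 h2]] [<- <-].
case=> m one lt bd; exists i, v; split=> // a.
by case: (one a) (lt a) => x xF [<- <-] [h1 h2]; exists x; rewrite // inE xF h1 h2.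
Qed.

Lemma good_le s F c r c' r' :
  filling F -> c' <= c -> r' <= r -> good s F c r -> good s F c' r'.
Proof.
move=> fF lec ler /(goodP _ _ _ fF)[i [v [m one lt bd]]].
apply/(goodP _ _ _ fF); exists i, v; split=> // a.
by case: (lt a) => /(leq_ltn_trans lec) ? /(leq_ltn_trans ler).
Qed.

Hypothesis yla : young_board la.

Lemma good_in_board s F c r : filling F -> good s F c r -> in_board la c r.
Proof.
move=> fF /(goodP _ _ _ fF)[i [v [_ _ lt bd]]].
(* The cell is south-west of the one in the last column of the occurrence and the row of its first
   letter, which is in the board by [bd]. *)
have [[_ lt_r] [lt_c _]] := (lt ord0, lt ord_max).
exact: in_board_le (ltnW lt_c) (ltnW lt_r) (bd ord0).
Qed.

(** The last column and the largest value of an occurrence of [p] form a corner; an occurrence of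
    [s] north-east of that corner is to the right of and above every letter of [p], as a direct sum
    demands. *)
Lemma contains_dsum p s F :
  filling F ->
  contains F (dsum p s) <->
  exists i v, [/\ @matches p i v, forall a, one_at F (i a) (v a) &
                  forall a, good s F (i ord_max) (v a)].
Proof.
move=> fF; split.
  case/(containsP _ fF) => i [v [/matches_dsum[mp ms ips vps] one bd]].
  exists (i \o @dsuml p s), (v \o @dsuml p s); split=> // a; first exact: one.
  apply/(goodP _ _ _ fF); exists (i \o @dsumr p s), (v \o @dsumr p s).
  split=> // b; [exact: one | by split; [apply: ips | apply: vps] |].
  by rewrite /= dsumr_max.
case=> i [v [mp one gd]].
(* Each [gd a] may give a different occurrence of [s]; the one for the maximal letter [m] serves all
   letters. *)
have [m vm] := matches_argmax mp.
have /(goodP _ _ _ fF)[i' [v' [ms one' lt bd]]] := gd m.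
have ilt a b : i a < i' b by apply: leq_ltn_trans (matches_last a mp) _; case: (lt b).
have vlt a b : v a < v' b by apply: leq_ltn_trans (vm a) _; case: (lt b).
apply/(containsP _ fF); exists (dsum_case i i'), (dsum_case v v'); split.
- apply/matches_dsum; split.
  + case: mp => inc iso adj; split=> [a b|a b|j]; rewrite /= !dsum_casel;
      [exact: inc | exact: iso | exact: adj].
  + case: ms => inc iso adj; split=> [a b|a b|j]; rewrite /= !dsum_caser;
      [exact: inc | exact: iso | exact: adj].
  + by move=> a b; rewrite dsum_casel dsum_caser.
  + by move=> a b; rewrite dsum_casel dsum_caser.
- by elim/dsum_ind => a; rewrite ?dsum_casel ?dsum_caser.
- rewrite -dsumr_max dsum_caser.
  elim/dsum_ind => a; rewrite ?dsum_casel ?dsum_caser //.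
  exact: in_board_le (leqnn _) (ltnW (vlt a ord0)) (bd ord0).
Qed.

(* The NE-maximal good cells of [F0] are witnessed by occurrences of [s] without
   good cells, which survive in [F]. Conversely, an occurrence in [F] that lies
   NE of a cell not good in [F0] uses no good cell of [F0], so it is in [F0]. *)
Lemma good_cells_stable s F F0 :
  filling F -> filling F0 ->
  F :\: good_cells s F0 = F0 :\: good_cells s F0 ->
  forall c r, good s F c r = good s F0 c r.
Proof.
move=> fF fF0 eqD.
have eqF (x : cell la) : ~~ good s F0 x.1 x.2 -> (x \in F) = (x \in F0).
  by move=> ng; have /setP/(_ x) := eqD; rewrite !inE ng.
move=> c r; apply/idP/idP; last first.
  (* Induction on the distance to the north-east corner of the bounding rectangle, which drops when
     moving to a good cell strictly north-east. *)
  have [n] := ubnP ((width la - c) + (height la - r)).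
  elim: n c r => // n IH c r ltn g0.
  have [i [v [ms one lt bd]]] := goodP _ _ _ fF0 g0.
  have [/existsP[a ga]|/existsPn nga] := boolP [exists a, good s F0 (i a) (v a)].
    have [ci rv] := lt a.
    have b := good_in_board fF0 ga.
    apply: (good_le fF (ltnW ci) (ltnW rv)); apply: IH ga.
    rewrite -ltnS; apply: leq_trans ltn; rewrite ltnS -addSn; apply: leq_add.
      by rewrite ltn_sub2l // (ltn_trans ci) // (in_board_width b).
    by rewrite leq_sub2l // ltnW.
  apply/(goodP _ _ _ fF); exists i, v; split=> // a.
  by case: (one a) (nga a) => x xF [<- <-] ng; exists x; rewrite // eqF.
case/(goodP _ _ _ fF) => i [v [ms one lt bd]].
case: (boolP (good s F0 c r)) => // ng; case/negP: (ng).
apply/(goodP _ _ _ fF0); exists i, v; split=> // a.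
case: (one a) (lt a) => x xF [<- <-] [h1 h2]; exists x; rewrite // -eqF //.
by apply: contra ng; apply: good_le => //; apply: ltnW.
Qed.

End Filling.

(** With [f] a coordinate projection, injectivity is the condition of at most one 1 per line and the
    image is the set of nonempty lines. Since [F] and [F0] agree outside [D], the lines left for the
    part inside [D] are those of [F0] minus the ones used outside. *)
Lemma split_imset_inj (T U : finType) (f : T -> U) (F F0 D : {set T}) :
  F :\: D = F0 :\: D -> {in F0 &, injective f} ->
  ({in F &, injective f} /\ f @: F = f @: F0) <->
  ({in F :&: D &, injective f} /\ f @: (F :&: D) = f @: (F0 :&: D)).
Proof.
have disj (A : {set T}) : {in A &, injective f} ->
    f @: (A :&: D) = (f @: A) :\: (f @: (A :\: D)).
  move=> injA; apply/setP => u; rewrite inE; apply/imsetP/andP.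
    case=> x /setIP[xA xD] ->; split; last exact: imset_f.
    apply/imsetP => -[y /setDP[yA yD] e]; case/negP: yD.
    by rewrite -(injA x y).
  case=> nD /imsetP[x xA e]; exists x => //; rewrite inE xA.
  by apply: contraR nD => xD; rewrite e imset_f // inE xD.
move=> eqD inj0; split=> [[injF eqF]|[injD eqFD]].
  split; last by rewrite !disj // eqF eqD.
  by apply: sub_in2 injF => x /setIP[].
have FE (A : {set T}) : f @: A = f @: (A :&: D) :|: f @: (A :\: D).
  by rewrite -imsetU setID.
(* A collision between inside and outside would, by the equality of images, already occur in [F0],
   where [f] is injective. *)
have cross x y : x \in F :&: D -> y \in F :\: D -> f x <> f y.
  move=> xD; rewrite eqD => yD e.
  have : f x \in f @: (F0 :&: D) by rewrite -eqFD imset_f.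
  by rewrite disj // inE e imset_f.
split; last by rewrite FE eqFD eqD -FE.
move=> x y xF yF e.
have [xD|xD] := boolP (x \in D); have [yD|yD] := boolP (y \in D).
- by apply: injD; rewrite // inE ?xF ?yF.
- by case: (cross x y); rewrite // inE ?xF ?xD ?yF ?yD.
- by case: (cross y x); rewrite // inE ?xF ?xD ?yF ?yD.
- apply: inj0 => //.
  + have : x \in F0 :\: D by rewrite -eqD inE xD.
    by case/setDP.
  + have : y \in F0 :\: D by rewrite -eqD inE yD.
    by case/setDP.
Qed.

(** * Transfer between [la] and the board [la'] formed by the good cells of a reference filling
    [F0] *)

Section Transfer.

Variables (la : seq nat) (yla : young_board la) (s : vincular).
Variables (C : {set 'I_(width la)}) (R : {set 'I_(height la)}).
Variable F0 : {set cell la}.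
Hypotheses (fF0 : filling F0) (F0C : empty_columns F0 = C)
  (F0R : empty_rows F0 = R).

Local Notation D := (good_cells s F0).

Variable la' : seq nat.
Implicit Type X : {set cell la'}.
Hypothesis yla' : young_board la'.
Hypothesis la'E : forall c r, in_board la' c r = good s F0 c r.

Lemma width_le : width la' <= width la.
Proof.
rewrite leqNgt; apply/negP => lt.
(* All columns of [la'] have positive height, so a column too many would contain a good cell outside
   [la]. *)
have b : in_board la' (width la) 0.
  by case/andP: yla' => _ /allP; apply; apply: mem_nth.
by have := in_board_width (good_in_board yla fF0 (etrans (esym (la'E _ _)) b)); rewrite ltnn.
Qed.

Lemma height_le : height la' <= height la.
Proof.
rewrite leqNgt; apply/negP => lt.
have b : in_board la' 0 (height la) by rewrite /in_board nth0.
have := in_board_height yla (good_in_board yla fF0 (etrans (esym (la'E _ _)) b)).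
by rewrite ltnn.
Qed.

Definition embed (x : cell la') : cell la :=
  (widen_ord width_le x.1, widen_ord height_le x.2).

Lemma widen_ord_inj m n (le_mn : m <= n) : injective (widen_ord le_mn).
Proof. by move=> x y /(congr1 val) /= e; apply: val_inj. Qed.

Lemma embed_inj : injective embed.
Proof.
by move=> [c r] [c' r'] [] /= e1 e2; congr pair; apply: val_inj.
Qed.

Lemma embed_good x : (embed x \in D) = in_board la' x.1 x.2.
Proof. by rewrite inE la'E. Qed.

Lemma good_embed x : x \in D -> exists y, x = embed y.
Proof.
rewrite inE -la'E => b.
exists (Ordinal (in_board_width b), Ordinal (in_board_height yla' b)).
by case: x b => c r b; congr pair; apply: val_inj.
Qed.

Definition glue (X : {set cell la'}) : {set cell la} :=
  (embed @: X) :|: (F0 :\: D).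

Definition inner (F : {set cell la}) : {set cell la'} :=
  embed @^-1: (F :&: D).

Lemma embed_inner F : embed @: inner F = F :&: D.
Proof.
apply/setP => x; apply/imsetP/idP => [[y + ->]|xFD]; first by rewrite inE.
have [y e] : exists y, x = embed y by apply: good_embed; case/setIP: xFD.
by exists y; rewrite // inE -e.
Qed.

Lemma inner_glue X :
  (forall x, x \in X -> in_board la' x.1 x.2) -> inner (glue X) = X.
Proof.
move=> bd; apply/setP => x.
rewrite in_set in_setI embed_good in_setU mem_imset; last exact: embed_inj.
rewrite in_setD embed_good; case: (boolP (x \in X)) => [/bd -> //|_].
by case: (in_board _ _ _); rewrite ?andbF.
Qed.

Lemma glueI X :
  (forall x, x \in X -> in_board la' x.1 x.2) -> glue X :&: D = embed @: X.
Proof. by move=> bd; rewrite -embed_inner inner_glue. Qed.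

Lemma glueD X :
  (forall x, x \in X -> in_board la' x.1 x.2) -> glue X :\: D = F0 :\: D.
Proof.
move=> bd; rewrite setDUl setDDl setUid (_ : _ :\: D = set0) ?set0U //.
apply/eqP; rewrite setD_eq0; apply/subsetP => _ /imsetP[x /bd b ->].
by rewrite embed_good.
Qed.

Lemma glue_inner F : F :\: D = F0 :\: D -> glue (inner F) = F.
Proof. by move=> e; rewrite /glue embed_inner -e setID. Qed.

Lemma inner_in_board F x : x \in inner F -> in_board la' x.1 x.2.
Proof. by rewrite -embed_good !inE => /andP[]. Qed.

(** Kept general in [f] so that it applies to columns and rows alike, in the format of
    [split_imset_inj]. *)
Lemma inj_imset_embed (m n : nat) (f' : cell la' -> 'I_m) (f : cell la -> 'I_n)
    (h : 'I_m -> 'I_n) X X0 :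
  injective h -> (forall x, f (embed x) = h (f' x)) ->
  ({in embed @: X &, injective f} /\ f @: (embed @: X) = f @: (embed @: X0)) <->
  ({in X &, injective f'} /\ f' @: X = f' @: X0).
Proof.
move=> injh comm.
have imE (A : {set cell la'}) : f @: (embed @: A) = h @: (f' @: A).
  by rewrite -!imset_comp; apply: eq_imset => x /=.
rewrite !imE; split=> -[inj e]; split; last 1 first.
- by rewrite e.
- move=> x y xX yX e'; apply: embed_inj; apply: inj; rewrite ?imset_f //.
  by rewrite !comm e'.
- exact: imset_inj e.
- move=> _ _ /imsetP[x xX ->] /imsetP[y yX ->]; rewrite !comm => /injh e'.
  by rewrite (inj x y).
Qed.

(** The prescribed empty lines of the small board are those of [inner F0]: they depend on the
    reference filling alone, hence not on the pattern to be avoided. *)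
Lemma glue_filling X :
  (forall x, x \in X -> in_board la' x.1 x.2) ->
  [&& filling (glue X), empty_columns (glue X) == C & empty_rows (glue X) == R]
  = [&& filling X, empty_columns X == empty_columns (inner F0)
      & empty_rows X == empty_rows (inner F0)].
Proof.
move=> bd; have [bd0 fc0 fr0] := fillingP _ fF0.
have [fc1 fc2] := split_imset_inj (glueD bd) fc0.
have [fr1 fr2] := split_imset_inj (glueD bd) fr0.
rewrite glueI // -embed_inner in fc1 fc2 fr1 fr2.
have [ec1 ec2] := @inj_imset_embed _ _ fst fst _ X (inner F0)
  (@widen_ord_inj _ _ width_le) (fun=> erefl).
have [er1 er2] := @inj_imset_embed _ _ snd snd _ X (inner F0)
  (@widen_ord_inj _ _ height_le) (fun=> erefl).
rewrite -F0C -F0R !empty_columnsE !empty_rowsE !(inj_eq (@setC_inj _)).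
apply/and3P/and3P => -[/fillingP[b fc fr] /eqP ec /eqP er].
  have [c1 c2] := ec1 (fc1 (conj fc ec)).
  have [r1 r2] := er1 (fr1 (conj fr er)).
  by split; [apply/fillingP | apply/eqP | apply/eqP].
have [c1 c2] := fc2 (ec2 (conj fc ec)).
have [r1 r2] := fr2 (er2 (conj fr er)).
split; [apply/fillingP; split=> // | exact/eqP | exact/eqP].
move=> x /setUP[/imsetP[y /bd yb ->]|/setDP[xF _]]; last exact: bd0.
by apply: (good_in_board (s := s) yla fF0); rewrite -la'E.
Qed.

(** By stability [glue X] has the same good cells as [F0]. An occurrence of [p] whose corner is good
    has all its ones in good cells, so it lives in [X]. *)
Lemma glue_contains p X :
  filling X -> filling (glue X) -> contains (glue X) (dsum p s) = contains X p.
Proof.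
move=> fX fG; have [bd _ _] := fillingP _ fX.
have gE := good_cells_stable yla fG fF0 (glueD bd).
apply/idP/idP.
  case/(contains_dsum yla p s fG) => i [v [m one gd]].
  have b a : in_board la' (i ord_max) (v a) by rewrite la'E -gE.
  apply/(containsP _ fX); exists i, v; split=> // a.
  have : in_board la' (i a) (v a).
    by apply: in_board_le (b a); rewrite // (matches_last _ m).
  case: (one a) => x xG [<- <-]; rewrite la'E => gx.
  have : x \in embed @: X by rewrite -glueI // inE xG inE.
  by case/imsetP => y yX ->; exists y.
case/(containsP _ fX) => i [v [m one b]].
apply/(contains_dsum yla p s fG); exists i, v; split=> // a.
  by case: (one a) => x xX [<- <-]; exists (embed x); rewrite // inE imset_f.
by rewrite gE -la'E.
Qed.

Lemma card_avoiders_transfer p :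
  #|[set F in avoiders C R (dsum p s) |
      (good_cells s F, F :\: good_cells s F) == (D, F0 :\: D)]|
  = #|avoiders (empty_columns (inner F0)) (empty_rows (inner F0)) p|.
Proof.
(* [glue] is the bijection; it is injective on these fillings because [inner] undoes it. *)
rewrite -(@card_in_imset _ _ glue); last first.
  move=> X Y; rewrite !inE => /and4P[/fillingP[bX _ _] _ _ _].
  by move=> /and4P[/fillingP[bY _ _] _ _ _] e; rewrite -(inner_glue bX) e inner_glue.
congr #|pred_of_set _|; apply/setP => F; apply/idP/imsetP.
  rewrite inE => /andP[+ /eqP[eD eF]]; rewrite eD in eF.
  rewrite -{1}(glue_inner eF) inE => /and4P[fG eC eR nc].
  have bd := @inner_in_board F.
  have := glue_filling bd; rewrite fG eC eR => /esym/and3P[fX eC' eR'].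
  exists (inner F); last by rewrite glue_inner.
  by rewrite inE fX eC' eR' -glue_contains.
case=> X XA ->; rewrite inE in XA; case/and4P: XA => fX eC eR nc.
have [bd _ _] := fillingP _ fX.
have := glue_filling bd; rewrite fX eC eR => /idP/and3P[fG eC' eR'].
have gE : good_cells s (glue X) = D.
  apply/setP => x; rewrite !inE; exact: good_cells_stable (glueD bd) _ _.
by rewrite !inE fG eC' eR' glue_contains // nc gE glueD //= eqxx.
Qed.

End Transfer.

(** * Summation over the classes of fillings *)

Theorem theorem2p1 (alpha beta sigma : vincular)
  (hab : filling_shape_Wilf_equivalent alpha beta) :
  filling_shape_Wilf_equivalent (dsum alpha sigma) (dsum beta sigma).
Proof.
move=> la yla C R.
(* Two fillings share a class when they have the same good cells and the same ones outside them. *)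
pose key (F : {set cell la}) := (good_cells sigma F, F :\: good_cells sigma F).
have cardE p : #|avoiders C R p| =
    \sum_k #|[set F in avoiders C R p | key F == k]|.
  rewrite -sum1_card (partition_big key xpredT) //=.
  by apply: eq_bigr => k _; rewrite -sum1_card; apply: eq_bigl => F; rewrite inE.
rewrite !cardE; apply: eq_bigr => k _.
(* The representative [F0] is any filling of the class with the prescribed empty lines, avoiding or
   not, so the same [F0] and [la'] serve both [alpha] and [beta]. Without such a filling both counts
   are 0. *)
have [/existsP[F0 /and4P[fF0 /eqP F0C /eqP F0R /eqP <-]]|none] := boolP
  [exists F, [&& filling F, empty_columns F == C, empty_rows F == R & key F == k]].
  have [||la' yla' la'E] := @young_board_of_downset (good sigma F0) (width la) (height la).
  - move=> c r /(good_in_board yla fF0) b.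
    by split; [apply: in_board_width b | apply: in_board_height b].
  - by move=> c r c' r'; apply: good_le.
  by rewrite !(card_avoiders_transfer yla fF0 F0C F0R yla' la'E) hab.
have empty p : [set F in avoiders C R p | key F == k] = set0.
  apply/setP => F; rewrite !inE; apply: contraNF none.
  by case/andP => /and4P[fF eC eR _] ek; apply/existsP; exists F; rewrite fF eC eR.
by rewrite !empty.
Qed.
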